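(* Let $W$ be the Coxeter group of the graph $T_{2,r+1,s-r-1}$ with generators $w_0,\dots,w_{s-1}$, acting on the real vector space $E$ with basis $x_0,\dots,x_{s-1}$ by the standard geometric representation, which preserves the bilinear form $B$. Let $W^1$ be the group of transformations of $V^1_{\mathbb{R}}$ generated by $\phi$ and the symmetric group on the $s$ indices. Let $\alpha: W\to W^1$ be the surjective group homomorphism with $\alpha(w_0)=\phi$ and $\alpha(w_i)=\tau_i$ for $1\le i\le s-1$, and let $\beta:E\to V^1_{\mathbb{R}}$ be the linear map with $\beta(x_i)=X_i$ for $0\le i\le s-1$. Then: (1) the group homomorphism $\alpha$ is an isomorphism; (2) the linear map $\beta$ is an isomorphism that preserves the bilinear forms, i.e. $B_1(\beta(x),\beta(y))=B(x,y)$ for all $x,y\in E$; (3) $\beta(w(x))=\alpha(w)(\beta(x))$ for all $w\in W$ and $x\in E$ (that is, $(\alpha,\beta)$ intertwines the action $W\times E\to E$ with the action $W^1\times V^1_{\mathbb{R}}\to V^1_{\mathbb{R}}$).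
   Context: Let $r\ge 2$ and $s\ge r+3$ be integers. $Y=Y^r_s$ is the blowup of $\mathbb{P}^r$ at $s$ general points; its divisor class group $A^1(Y)$ is free with basis $H$ (pullback of the hyperplane class) and $E_1,\dots,E_s$ (exceptional divisors). Its curve class group $A^{r-1}(Y)$ is free with basis $h$ (class of a general line) and $e_1,\dots,e_s$ ($e_i$ the class of a line in $E_i$). The intersection pairing is $(H\cdot h)=1$, $(H\cdot e_i)=(E_i\cdot h)=0$, $(E_i\cdot e_j)=-\delta_{ij}$. The standard Cremona action $\phi$ on $A^1(Y)$ sends $dH-\sum_i m_iE_i$ to $d'H-\sum_i m_i'E_i$ where, with $t_1=(r-1)d-\sum_{i=1}^{r+1}m_i$, $d'=d+t_1$, $m_i'=m_i+t_1$ for $1\le i\le r+1$, and $m_i'=m_i$ for $i>r+1$. The symmetric group acts by permuting the $E_i$; $\tau_i$ denotes the transposition $(i,i+1)$, $1\le i\le s-1$. Let $F=(r+1)h-\sum_i e_i\in A^{r-1}(Y)$ and let $V^1\subset A^1(Y)$ be the subspace of classes $D$ with $(D\cdot F)=0$, i.e. of $dH-\sum m_iE_i$ with $(r+1)d=\sum_i m_i$; $V^1_{\mathbb{R}}=V^1\otimes\mathbb{R}$. It is preserved by $\phi$ and the symmetric group, and has basis $X_0=H-\sum_{i=1}^{r+1}E_i$ and $X_i=E_i-E_{i+1}$ for $1\le i\le s-1$. The symmetric bilinear form $B_1$ is $B_1(x,y)=-\frac14\left(q_1(x+y)-q_1(x)-q_1(y)\right)$ with $q_1(dH-\sum m_iE_i)=(r-1)d^2-\sum_i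 m_i^2$. The graph $T_{2,r+1,s-r-1}$ has vertices $0,1,\dots,s-1$, with edges $\{i,i+1\}$ for $1\le i\le s-2$ and $\{0,r+1\}$. The Coxeter group $W$ has generators $w_0,\dots,w_{s-1}$ and relations $w_i^2=1$, $w_iw_j=w_jw_i$ if $i\neq j$ are not joined by an edge, $w_iw_jw_i=w_jw_iw_j$ if they are. On $E$ the form $B$ is symmetric with $B(x_i,x_i)=1$, $B(x_i,x_j)=0$ if $i\ne j$ are not joined, and $B(x_i,x_j)=-1/2$ if joined. In the standard geometric representation $w_i$ acts by the reflection $\sigma_i(x)=x-2B(x,x_i)x_i$. *)

(* Defs.v *)
From HB Require Import structures.
From mathcomp Require Import all_boot all_order all_fingroup all_algebra.
From mathcomp Require Import generic_quotient boolp reals ring zify.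

Set Implicit Arguments.
Unset Strict Implicit.
Unset Printing Implicit Defensive.

Import GRing.Theory Num.Theory.
Local Open Scope ring_scope.

(* Products are compositions of functions, (f * g) v = f (g v), so that a     *)
(* homomorphism W -> GLV V is a left linear action of W on V.                 *)
Section GeneralLinear.
Variables (K : fieldType) (V : vectType K).

Record GLV := MkGLV { glv_lfun :> 'End(V); glv_inj : lker glv_lfun == 0%VS }.

HB.instance Definition _ := [isSub for glv_lfun].
HB.instance Definition _ := [Choice of GLV by <:].

Fact glv_one_subproof : lker (\1%VF : 'End(V)) == 0%VS.
Proof. by apply/lker0P => u v; rewrite !lfunE. Qed.
Definition glv_one := MkGLV glv_one_subproof.

Fact glv_mul_subproof (f g : GLV) : lker (f \o g)%VF == 0%VS.
Proof.
apply/lker0P => u v; rewrite !lfunE /=.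
by move=> /(lker0P (glv_inj f))/(lker0P (glv_inj g)).
Qed.
Definition glv_mul f g := MkGLV (glv_mul_subproof f g).

Fact glv_inv_subproof (f : GLV) : lker (f^-1)%VF == 0%VS.
Proof. exact/lker0P/(can_inj (lker0_lfunVK (glv_inj f))). Qed.
Definition glv_inv f := MkGLV (glv_inv_subproof f).

Fact glv_mulA : associative glv_mul.
Proof. by move=> f g h; apply/val_inj; rewrite /= comp_lfunA. Qed.
Fact glv_mul1 : left_id glv_one glv_mul.
Proof. by move=> f; apply/val_inj; rewrite /= comp_lfun1l. Qed.
Fact glv_1mul : right_id glv_one glv_mul.
Proof. by move=> f; apply/val_inj; rewrite /= comp_lfun1r. Qed.
Fact glv_mulV : left_inverse glv_one glv_inv glv_mul.
Proof. by move=> f; apply/val_inj; rewrite /= lker0_compVf ?glv_inj. Qed.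
Fact glv_Vmul : right_inverse glv_one glv_inv glv_mul.
Proof. by move=> f; apply/val_inj; rewrite /= lker0_compfV ?glv_inj. Qed.

HB.instance Definition _ :=
  isGroup.Build GLV glv_mulA glv_mul1 glv_1mul glv_mulV glv_Vmul.

Lemma glvM (f g : GLV) v : (f * g)%g v = f (g v).
Proof. by rewrite lfunE. Qed.

Lemma glv1 v : (1%g : GLV) v = v.
Proof. by rewrite lfunE. Qed.

Lemma glvP (f g : GLV) : (forall v, f v = g v) -> f = g.
Proof. by move=> fg; apply/val_inj/lfunP. Qed.

Lemma glv_of_can (f g : 'End(V)) :
  cancel f g -> exists h : GLV, forall v, h v = f v.
Proof.
by move=> fK; exists (MkGLV (introT (lker0P (f := f)) (can_inj fK))).
Qed.

End GeneralLinear.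

Inductive generated_by (G : groupType) (S : G -> Prop) : G -> Prop :=
  | gen_in g of S g : generated_by S g
  | gen_one : generated_by S 1%g
  | gen_mul g h of generated_by S g & generated_by S h :
      generated_by S (g * h)%g
  | gen_inv g of generated_by S g : generated_by S g^-1%g.

(* The group is presented as the monoid with the same generators and          *)
(* relations: the relations w_i^2 = 1 make every generator its own inverse.   *)
Section CoxeterGroup.
Variables (n : nat) (edge : rel 'I_n).

Inductive cox_rel : seq 'I_n -> seq 'I_n -> Prop :=
  | cox_invol i : cox_rel [:: i; i] [::]
  | cox_comm i j of i != j & ~~ edge i j : cox_rel [:: i; j] [:: j; i]
  | cox_braid i j of i != j & edge i j : cox_rel [:: i; j; i] [:: j; i; j].

Inductive cox_cong : seq 'I_n -> seq 'I_n -> Prop :=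
  | cox_step a b u v of cox_rel u v : cox_cong (a ++ u ++ b) (a ++ v ++ b)
  | cox_refl u : cox_cong u u
  | cox_sym u v of cox_cong u v : cox_cong v u
  | cox_trans u v w of cox_cong u v & cox_cong v w : cox_cong u w.

Definition cox_congb : rel (seq 'I_n) := fun u v => `[< cox_cong u v >].

Fact cox_congb_refl : reflexive cox_congb.
Proof. by move=> u; apply/asboolP/cox_refl. Qed.
Fact cox_congb_sym : symmetric cox_congb.
Proof. by move=> u v; apply/asboolP/asboolP => /cox_sym. Qed.
Fact cox_congb_trans : transitive cox_congb.
Proof.
by move=> v u w /asboolP uv /asboolP vw; apply/asboolP/(cox_trans uv vw).
Qed.

Canonical cox_equiv :=
  EquivRel cox_congb cox_congb_refl cox_congb_sym cox_congb_trans.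

Definition coxeter := {eq_quot cox_equiv}%qT.
HB.instance Definition _ := Choice.on coxeter.

Definition cox_word (u : seq 'I_n) : coxeter :=
  (\pi_({eq_quot cox_equiv}) u)%qT.
Definition cox_gen (i : 'I_n) : coxeter := cox_word [:: i].

Lemma cox_wordP u v : cox_word u = cox_word v <-> cox_cong u v.
Proof.
split=> [/eqquotP|uv]; first by move/asboolP.
by apply/eqquotP/asboolP.
Qed.

Definition cox_repr (w : coxeter) : seq 'I_n := repr w.

Lemma cox_reprK : cancel cox_repr cox_word.
Proof. by move=> w; rewrite /cox_word /cox_repr reprK. Qed.

Lemma cox_cong_ctx a b u v :
  cox_cong u v -> cox_cong (a ++ u ++ b) (a ++ v ++ b).
Proof.
elim=> {u v} [c d u v uv|u|u v _|u v w _ uv _]; last 3 first.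
- exact: cox_refl.
- exact: cox_sym.
- exact: cox_trans uv.
by have := cox_step (a ++ c) (d ++ b) uv; rewrite -!catA.
Qed.

Lemma cox_cong_cat u u' v v' :
  cox_cong u u' -> cox_cong v v' -> cox_cong (u ++ v) (u' ++ v').
Proof.
move=> /(cox_cong_ctx [::] v) uu' /(cox_cong_ctx u' [::]).
by rewrite !cats0; apply: cox_trans uu'.
Qed.

Lemma cox_cong_rev u v : cox_cong u v -> cox_cong (rev u) (rev v).
Proof.
elim=> {u v} [a b u v uv|u|u v _|u v w _ uv _]; last 3 first.
- exact: cox_refl.
- exact: cox_sym.
- exact: cox_trans uv.
rewrite !rev_cat -!catA; apply: cox_cong_ctx.
case: uv => [i|i j ij eij|i j ij eij].
- exact: (cox_step [::] [::] (cox_invol i)).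
- exact/cox_sym/(cox_step [::] [::] (cox_comm ij eij)).
- exact: (cox_step [::] [::] (cox_braid ij eij)).
Qed.

Lemma cox_cong_catV u : cox_cong (rev u ++ u) [::].
Proof.
elim: u => [|i u IHu]; first exact: cox_refl.
rewrite rev_cons cat_rcons; apply: cox_trans IHu.
exact: (cox_step (rev u) u (cox_invol i)).
Qed.

Definition cox_one : coxeter := cox_word [::].
Definition cox_mul (v w : coxeter) : coxeter :=
  cox_word (cox_repr v ++ cox_repr w).
Definition cox_inv (w : coxeter) : coxeter := cox_word (rev (cox_repr w)).

Lemma cox_mul_word u v : cox_mul (cox_word u) (cox_word v) = cox_word (u ++ v).
Proof. by apply/cox_wordP/cox_cong_cat; apply/cox_wordP/cox_reprK. Qed.

Lemma cox_inv_word u : cox_inv (cox_word u) = cox_word (rev u).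
Proof. by apply/cox_wordP/cox_cong_rev/cox_wordP/cox_reprK. Qed.

Fact cox_mulA : associative cox_mul.
Proof.
move=> u v w; rewrite -[u]cox_reprK -[v]cox_reprK -[w]cox_reprK.
by rewrite !cox_mul_word catA.
Qed.
Fact cox_mul1 : left_id cox_one cox_mul.
Proof. by move=> u; rewrite -[u]cox_reprK cox_mul_word. Qed.
Fact cox_1mul : right_id cox_one cox_mul.
Proof. by move=> u; rewrite -[u]cox_reprK cox_mul_word cats0. Qed.
Fact cox_mulV : left_inverse cox_one cox_inv cox_mul.
Proof.
move=> u; rewrite -[u]cox_reprK cox_inv_word cox_mul_word.
exact/cox_wordP/cox_cong_catV.
Qed.
Fact cox_Vmul : right_inverse cox_one cox_inv cox_mul.
Proof.
move=> u; rewrite -[u]cox_reprK cox_inv_word cox_mul_word.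
by apply/cox_wordP; rewrite -{1}[cox_repr u]revK; apply: cox_cong_catV.
Qed.

HB.instance Definition _ :=
  isGroup.Build coxeter cox_mulA cox_mul1 cox_1mul cox_mulV cox_Vmul.

Lemma cox_wordE u : cox_word u = (\prod_(i <- u) cox_gen i)%g.
Proof.
elim: u => [|i u IHu]; first by rewrite big_nil.
by rewrite big_cons -IHu; symmetry; apply: (cox_mul_word [:: i]).
Qed.

Section UniversalProperty.
Variables (G : groupType) (f : 'I_n -> G).
Hypothesis f_invol : forall i, (f i * f i)%g = 1%g.
Hypothesis f_comm : forall i j, i != j -> ~~ edge i j ->
  (f i * f j)%g = (f j * f i)%g.
Hypothesis f_braid : forall i j, i != j -> edge i j ->
  (f i * f j * f i)%g = (f j * f i * f j)%g.

Lemma cox_cong_prod u v : cox_cong u v ->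
  (\prod_(i <- u) f i)%g = (\prod_(i <- v) f i)%g.
Proof.
elim=> {u v} [a b u v uv|//|//|u v w _ -> _ //].
rewrite !big_cat /=; congr (_ * (_ * _))%g.
case: uv => [i|i j ij eij|i j ij eij]; rewrite !big_cons !big_nil !mulg1.
- exact: f_invol.
- exact: f_comm.
- by rewrite !mulgA f_braid.
Qed.

Lemma coxeter_universal : exists h : {multiplicative coxeter -> G},
  forall i, h (cox_gen i) = f i.
Proof.
pose h (w : coxeter) := (\prod_(i <- cox_repr w) f i)%g.
have hE u : h (cox_word u) = (\prod_(i <- u) f i)%g.
  by apply: cox_cong_prod; apply/cox_wordP; rewrite cox_reprK.
have hM : {morph h : x y / (x * y)%g}.
  by move=> x y; rewrite [LHS](hE (cox_repr x ++ cox_repr y)) big_cat.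
pose hm := isMultiplicative.Build coxeter G h hM.
pose H : {multiplicative coxeter -> G} := HB.pack h hm.
by exists H => i; rewrite /= hE big_cons big_nil mulg1.
Qed.

End UniversalProperty.
End CoxeterGroup.

Section GeometricRepresentation.
Variables (K : realFieldType) (n : nat) (edge : rel 'I_n).

(* The values B(x_i, x_j) on the basis x_i = delta_mx 0 i of E = 'rV_n.       *)
Definition cox_gram (i j : 'I_n) : K :=
  if i == j then 1 else if edge i j then - 2^-1 else 0.

Definition cox_form (x y : 'rV[K]_n) : K :=
  \sum_i \sum_j x 0 i * y 0 j * cox_gram i j.

Definition cox_basis (i : 'I_n) : 'rV[K]_n := delta_mx 0 i.

Definition cox_reflection (i : 'I_n) (x : 'rV[K]_n) : 'rV[K]_n :=
  x - (2 * cox_form x (cox_basis i)) *: cox_basis i.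

Definition is_geometric_rep (rho : coxeter edge -> GLV 'rV[K]_n) :=
  forall i x, rho (cox_gen edge i) x = cox_reflection i x.

End GeometricRepresentation.

(* The vertices of T_{2,r+1,s-r-1} are 0, ..., s-1; the edge {0, r+1} joins   *)
(* vertex 0 to the path 1 - 2 - ... - (s-1).                                  *)
Definition T_edge (r s : nat) : rel 'I_s := fun i j =>
  let e (a b : nat) := ((0 < a) && (b == a.+1) || (a == 0) && (b == r.+1))%N in
  e i j || e j i.
Arguments T_edge r s : clear implicits.

(* (d, m) stands for the divisor class dH - sum m_i E_i (real coefficients)   *)
(* and for the curve class dh - sum m_ie_i. The points are indexed by 'I_s:   *)
(* the ordinal i corresponds to E_{i+1} and e_{i+1}.                          *)
Section BlowupClasses.
Variables (K : realFieldType) (r s : nat).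

Definition divisor_class : Type := (K^o * 'rV[K]_s)%type.
Definition curve_class : Type := (K^o * 'rV[K]_s)%type.
HB.instance Definition _ := Vector.on divisor_class.
HB.instance Definition _ := Vector.on curve_class.

Definition clsH : divisor_class := (1, 0).
Definition clsE (i : 'I_s) : divisor_class := (0, - delta_mx 0 i).

Definition pairing (D : divisor_class) (C : curve_class) : K :=
  D.1 * C.1 - \sum_i D.2 0 i * C.2 0 i.

Definition clsF : curve_class := (r.+1%:R, const_mx 1).

Definition degF (D : divisor_class) : K^o := pairing D clsF.

Fact degF_linear : linear degF.
Proof.
move=> a D D'; rewrite /degF /pairing /=.
have sumE x : \sum_i (x : 'rV[K]_s) 0 i * (const_mx 1 : 'rV[K]_s) 0 i
              = \sum_i x 0 i.
  by apply: eq_bigr => i _; rewrite mxE mulr1.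
have -> : \sum_i (a *: D + D').2 0 i * (const_mx 1 : 'rV[K]_s) 0 i
          = a * (\sum_i D.2 0 i) + \sum_i D'.2 0 i.
  rewrite sumE mulr_sumr -big_split; apply: eq_bigr => i _.
  by rewrite !mxE.
by rewrite !sumE /GRing.scale /=; ring.
Qed.
HB.instance Definition _ :=
  GRing.isLinear.Build K divisor_class K^o *:%R degF degF_linear.

Definition V1 : {vspace divisor_class} := lker (linfun degF).

Lemma memV1 D : (D \in V1) = (degF D == 0).
Proof. by rewrite memv_ker lfunE. Qed.

Definition cremona (D : divisor_class) : divisor_class :=
  let t := (r%:R - 1) * D.1 - \sum_(i < s | (i < r.+1)%N) D.2 0 i in
  (D.1 + t, \row_i (if (i < r.+1)%N then D.2 0 i + t else D.2 0 i)).

Definition permute (p : 'S_s) (D : divisor_class) : divisor_class :=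
  (D.1, \row_i D.2 0 ((p^-1)%g i)).

(* For 1 <= i <= s-1, the transposition (i, i+1) of the indices 1, ..., s is  *)
(* the transposition of the ordinals i-1 and i.                               *)
Definition tau (i : 'I_s) : 'S_s := tperm (ord_pred i) i.

(* "g is the transformation of V1 induced by f". Such a g is unique; it exists*)
(* for every permutation, and for cremona when r < s (see alpha_exists).      *)
Definition restricts_to (g : GLV (subvs_of V1))
    (f : divisor_class -> divisor_class) :=
  forall v, vsval (g v) = f (vsval v).

Definition W1_generator (g : GLV (subvs_of V1)) : Prop :=
  restricts_to g cremona \/ exists p : 'S_s, restricts_to g (permute p).

Record W1 := MkW1 {
  W1_glv :> GLV (subvs_of V1);
  W1P : `[< generated_by W1_generator W1_glv >]
}.

HB.instance Definition _ := [isSub for W1_glv].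
HB.instance Definition _ := [Choice of W1 by <:].

Fact W1_group_closed :
  group_closed (fun g : GLV (subvs_of V1) =>
    `[< generated_by W1_generator g >]).
Proof.
split=> [|g h /asboolP gP /asboolP hP]; apply/asboolP; first exact: gen_one.
exact/gen_mul/gen_inv.
Qed.

HB.instance Definition _ := SubChoice_isSubGroup.Build _ _ W1 W1_group_closed.

Definition clsX (i : 'I_s) : divisor_class :=
  if i == 0%N :> nat then clsH - \sum_(j < s | (j < r.+1)%N) clsE j
  else clsE (ord_pred i) - clsE i.

Definition q1 (D : divisor_class) : K :=
  (r%:R - 1) * D.1 ^+ 2 - \sum_i D.2 0 i ^+ 2.

Definition B1 (x y : divisor_class) : K :=
  - 4^-1 * (q1 (x + y) - q1 x - q1 y).

End BlowupClasses.

Section Reflections.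
Variables (K : realFieldType) (V : vectType K) (b : V -> V -> K).
Hypothesis b_linear : forall y a u v, b (a *: u + v) y = a * b u y + b v y.
Variables (n : nat) (edge : rel 'I_n) (x : 'I_n -> V).
Hypothesis edge_sym : symmetric edge.
Hypothesis b_gram : forall i j, b (x i) (x j) = cox_gram K edge i j.

Let refl i v := v - (2 * b v (x i)) *: x i.

Let bB u a v y : b (u - a *: v) y = b u y - a * b v y.
Proof. by rewrite addrC -scaleNr b_linear mulNr addrC. Qed.

Lemma reflK i : involutive (refl i).
Proof.
move=> v; rewrite /refl bB b_gram /cox_gram eqxx mulr1 -addrA -opprD -scalerDl.
suff -> : 2 * b v (x i) + 2 * (b v (x i) - 2 * b v (x i)) = 0.
  by rewrite scale0r subr0.
by ring.
Qed.

Lemma refl_comm i j v : i != j -> ~~ edge i j ->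
  refl i (refl j v) = refl j (refl i v).
Proof.
move=> ij eij; rewrite /refl !bB !b_gram /cox_gram eq_sym (negPf ij).
rewrite (edge_sym j i) (negPf eij) !mulr0 !subr0.
by rewrite -!addrA [X in v + X]addrC.
Qed.

Lemma refl_braid i j v : i != j -> edge i j ->
  refl i (refl j (refl i v)) = refl j (refl i (refl j v)).
Proof.
have step k l (a c : K) : k != l -> edge k l ->
    refl k (v - a *: x k - c *: x l) =
      v - (2 * b v (x k) - a + c) *: x k - c *: x l.
  move=> kl ekl; rewrite /refl !bB !b_gram /cox_gram eqxx eq_sym (negPf kl).
  rewrite (edge_sym l k) ekl -!addrA; congr (v + _).
  rewrite addrCA -opprD -scalerDl addrC; congr (- (_ *: _) + _).
  by field.
have tri k l : k != l -> edge k l -> refl k (refl l (refl k v)) =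
    v - (2 * (b v (x k) + b v (x l))) *: x k
      - (2 * (b v (x k) + b v (x l))) *: x l.
  move=> kl ekl; have lk : l != k by rewrite eq_sym.
  have elk : edge l k by rewrite edge_sym.
  have {1}-> : v = v - 0 *: x k - 0 *: x l by rewrite !scale0r !subr0.
  rewrite (step k l) // addrAC (step l k) // addrAC (step k l) //.
  by congr (_ - _ *: _ - _ *: _); ring.
move=> ij eij; rewrite !tri //; last 2 first.
- by rewrite eq_sym.
- by rewrite edge_sym.
by rewrite [b v (x j) + _]addrC addrAC.
Qed.

Lemma coxeter_act_reflections (G : groupType) (act : G -> GLV V)
    (f : 'I_n -> G) :
  injective act -> {morph act : g h / (g * h)%g} ->
  (forall i v, act (f i) v = v - (2 * b v (x i)) *: x i) ->
  exists h : {multiplicative coxeter edge -> G},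
    forall i, h (cox_gen edge i) = f i.
Proof.
move=> act_inj actM actE.
have act1 : act 1%g = 1%g.
  by apply: (mulgI (act 1%g)); rewrite -actM !mulg1.
apply: coxeter_universal => [i|i j ij eij|i j ij eij];
  apply: act_inj; apply: glvP => v; rewrite ?act1 ?glv1 !actM !glvM !actE.
- exact: reflK.
- exact: refl_comm.
- exact: refl_braid.
Qed.

End Reflections.

Lemma geometric_rep_exists (K : realFieldType) n (edge : rel 'I_n) :
  symmetric edge ->
  exists rho : {multiplicative coxeter edge -> GLV 'rV[K]_n},
    is_geometric_rep rho.
Proof.
move=> edge_sym; pose b := @cox_form K n edge.
have b_linear y a u v : b (a *: u + v) y = a * b u y + b v y.
  rewrite /b /cox_form mulr_sumr -big_split; apply: eq_bigr => i _ /=.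
  rewrite mulr_sumr -big_split; apply: eq_bigr => j _ /=.
  by rewrite !mxE; ring.
have b_gram i j : b (cox_basis K i) (cox_basis K j) = cox_gram K edge i j.
  rewrite /b /cox_form (bigD1 i) //= (bigD1 j) //= !mxE !eqxx /= !mul1r.
  rewrite !big1 ?addr0 // => [k /negPf ki|k /negPf kj].
    by rewrite big1 // => l _; rewrite !mxE ki andbF !mul0r.
  by rewrite !mxE kj andbF mulr0 mul0r.
have rlin i : linear (cox_reflection edge i : 'rV[K]_n -> 'rV[K]_n).
  move=> a u v; rewrite /cox_reflection -/b b_linear mulrDr scalerDl.
  rewrite mulrCA -(scalerA a) scalerBr -!addrA; congr (_ + _).
  by rewrite opprD addrCA.
have /choice[f fE] : forall i : 'I_n, exists g : GLV 'rV[K]_n,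
    forall v, g v = cox_reflection edge i v.
  move=> i.
  pose ra := GRing.isLinear.Build K _ _ *:%R _ (rlin i).
  pose rl : {linear 'rV[K]_n -> 'rV[K]_n} := HB.pack (cox_reflection edge i) ra.
  have [|g gE] := @glv_of_can _ _ (linfun rl) (linfun rl).
    by move=> v; rewrite !lfunE /=; apply: (reflK b_linear b_gram).
  by exists g => v; rewrite gE lfunE.
have [h hE] := coxeter_act_reflections b_linear edge_sym b_gram
  (act := id) (fun _ _ => id) (fun _ _ => erefl) fE.
by exists h => i v; rewrite hE fE.
Qed.

Section AlphaExists.
Variables (K : realFieldType) (r s : nat).
Hypothesis lt_rs : (r < s)%N.

Local Notation cls := (divisor_class K s).
Local Notation X := (@clsX K r s).
Local Notation V := (subvs_of (V1 K r s)).

Lemma B1E (D D' : cls) :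
  B1 r D D' = - 2^-1 * ((r%:R - 1) * D.1 * D'.1 - \sum_i D.2 0 i * D'.2 0 i).
Proof.
rewrite /B1 /q1 /=.
have -> : \sum_i (D.2 + D'.2) 0 i ^+ 2 = \sum_i D.2 0 i ^+ 2 +
    \sum_i D'.2 0 i ^+ 2 + 2 * \sum_i D.2 0 i * D'.2 0 i.
  rewrite mulr_sumr -!big_split; apply: eq_bigr => i _ /=.
  by rewrite mxE; ring.
by field.
Qed.

Lemma B1_sym (D D' : cls) : B1 r D D' = B1 r D' D.
Proof. by rewrite /B1 [D' + D]addrC; ring. Qed.

Lemma B1_linear (D' : cls) a D1 D2 :
  B1 r (a *: D1 + D2) D' = a * B1 r D1 D' + B1 r D2 D'.
Proof.
rewrite !B1E /=.
have -> : \sum_i (a *: D1 + D2).2 0 i * D'.2 0 i =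
    a * (\sum_i D1.2 0 i * D'.2 0 i) + \sum_i D2.2 0 i * D'.2 0 i.
  rewrite mulr_sumr -big_split; apply: eq_bigr => i _ /=.
  by rewrite !mxE; ring.
by rewrite /GRing.scale /=; ring.
Qed.

Lemma degFE (D : cls) : degF r D = r.+1%:R * D.1 - \sum_i D.2 0 i.
Proof.
rewrite /degF /pairing /= mulrC; congr (_ - _).
by apply: eq_bigr => i _; rewrite mxE mulr1.
Qed.

Lemma ord_predE (i : 'I_s) : (0 < i)%N -> ord_pred i = i.-1 :> nat.
Proof.
case: i => -[|i] //= lt_is _.
by rewrite modnDr modn_small // ltnW.
Qed.

Lemma ord_eqE (i j : 'I_s) : (i == j) = (i == j :> nat).
Proof. by []. Qed.

Lemma ord_pred_neq (i : 'I_s) : (0 < i)%N -> ord_pred i != i.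
Proof. by move=> i0; rewrite ord_eqE ord_predE //; lia. Qed.

Lemma X0E (i : 'I_s) : i = 0%N :> nat ->
  X i = (1, \row_j (j < r.+1)%N%:R) :> cls.
Proof.
move=> i0; rewrite /clsX i0 eqxx.
have -> : \sum_(j < s | (j < r.+1)%N) clsE K j =
    (0, - \row_j (j < r.+1)%N%:R) :> cls.
  apply: (@eq_trans _ _ (\sum_(j < s | (j < r.+1)%N) (clsE K j).1,
                         \sum_(j < s | (j < r.+1)%N) (clsE K j).2)).
    by elim/big_rec3: _ => // j x y z _ ->.
  rewrite big1 //; congr pair; apply/rowP => k; rewrite !mxE summxE.
  under eq_bigr do rewrite !mxE.
  rewrite sumrN; congr (- _); case: ltnP => [kr|rk].
    rewrite (bigD1 k) //= !eqxx big1 ?addr0 // => j /andP[_ /negPf jk].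
    by rewrite eq_sym jk.
  rewrite big1 // => j jr; have /negPf -> // : k != j.
  by apply: contraTneq jr => <-; rewrite -leqNgt.
by congr pair => /=; rewrite ?subr0 // sub0r opprK.
Qed.

Lemma XSE (i : 'I_s) : (0 < i)%N ->
  X i = (0, \row_j ((j == i)%:R - (j == i.-1 :> nat)%:R)) :> cls.
Proof.
move=> i0; rewrite /clsX -[_ == 0%N]negbK -lt0n i0 /=.
congr pair; first by rewrite subr0.
apply/rowP => j; rewrite !mxE /= opprK addrC -(ord_predE i0).
by [].
Qed.

Lemma B1_X0 (D : cls) (i : 'I_s) : i = 0%N :> nat ->
  B1 r D (X i) =
  - 2^-1 * ((r%:R - 1) * D.1 - \sum_(j < s | (j < r.+1)%N) D.2 0 j).
Proof.
move=> i0; rewrite B1E X0E //= mulr1; congr (_ * (_ - _)).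
rewrite [RHS]big_mkcond; apply: eq_bigr => j _; rewrite mxE.
by case: ltnP; rewrite ?mulr1 ?mulr0.
Qed.

Lemma B1_XS (D : cls) (i : 'I_s) : (0 < i)%N ->
  B1 r D (X i) = 2^-1 * (D.2 0 i - D.2 0 (ord_pred i)).
Proof.
move=> i0; rewrite B1E XSE //= mulr0 sub0r mulrNN; congr (_ * _).
have pi := ord_pred_neq i0.
rewrite (bigD1 i) //= (bigD1 (ord_pred i)) //= !mxE eqxx ord_predE // eqxx.
rewrite (negPf pi) big1 => [|j /andP[/negPf ji /negPf jpi]].
  by rewrite -{1}[i in i == _ :> nat]prednK // eqn_leq ltnn /=; ring.
by rewrite mxE ji -(ord_predE i0) val_eqE jpi subrr mulr0.
Qed.

Lemma sum_ltr : \sum_(j < s | (j < r.+1)%N) 1 = r.+1%:R :> K.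
Proof.
rewrite -(big_ord_widen _ (fun _ => 1)) // sumr_const card_ord //.
Qed.

Lemma X_V1 i : X i \in V1 K r s.
Proof.
rewrite memV1 degFE; have [i0|i0] := posnP i.
  rewrite X0E //= mulr1 -sum_ltr [X in _ - X](_ : _ =
    \sum_(j < s | (j < r.+1)%N) 1) ?subrr //.
  rewrite [RHS]big_mkcond; apply: eq_bigr => j _; rewrite mxE.
  by case: ltnP.
rewrite XSE //= mulr0 sub0r oppr_eq0.
under eq_bigr do rewrite mxE.
have sum1 k : \sum_(j < s) (j == k)%:R = 1 :> K.
  by rewrite (bigD1 k) //= eqxx big1 ?addr0 // => j /negPf ->.
rewrite sumrB sum1 [X in _ - X](_ : _ = 1) ?subrr // -[RHS](sum1 (ord_pred i)).
by apply: eq_bigr => j _; rewrite ord_eqE ord_predE.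
Qed.

Lemma B1_gram i j : B1 r (X i) (X j) = cox_gram K (T_edge r s) i j.
Proof.
have gramS (k l : 'I_s) : (0 < l)%N ->
    B1 r (X k) (X l) = cox_gram K (T_edge r s) k l.
  move=> l0; rewrite B1_XS // /cox_gram ord_eqE.
  have [k0|k0] := posnP k.
    have -> : T_edge r s k l = (l == r.+1 :> nat) by rewrite /T_edge; lia.
    rewrite X0E // !mxE ord_predE // k0.
    have -> : (0%N == l) = false by lia.
    case: (eqVneq (l : nat) r.+1) => [->|lr].
      by rewrite /= ltnn ltnSn mulr0n mulr1n; field.
    have -> : (l < r.+1)%N = (l.-1 < r.+1)%N by lia.
    by ring.
  have -> : T_edge r s k l = (l.-1 == k :> nat) || (l == k.-1 :> nat).
    by rewrite /T_edge; lia.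
  rewrite XSE // !mxE !ord_eqE ord_predE //.
  have [->|kl] := eqVneq (k : nat) l.
    have -> : (l == l.-1 :> nat) = false by lia.
    have -> : (l.-1 == l :> nat) = false by lia.
    by rewrite !eqxx !mulr0n !mulr1n; field.
  have -> : (l.-1 == k.-1 :> nat) = false by lia.
  case: (eqVneq l.-1 (k : nat)) => [lk|_];
    case: (eqVneq (l : nat) k.-1) => [lk'|_];
    rewrite /= ?mulr0n ?mulr1n.
  - lia.
  - by ring.
  - by ring.
  - by ring.
have gram_sym k l : cox_gram K (T_edge r s) k l = cox_gram K (T_edge r s) l k.
  by rewrite /cox_gram eq_sym /T_edge orbC.
have [j0|j0] := posnP j; last exact: gramS.
have [i0|i0] := posnP i; last by rewrite B1_sym gramS // gram_sym.
have -> : i = j by apply/val_inj; rewrite /= i0.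
rewrite /cox_gram eqxx B1_X0 // X0E //=.
rewrite [X in _ - X](_ : _ = \sum_(k < s | (k < r.+1)%N) 1); last first.
  by apply: eq_bigr => k kr; rewrite mxE kr.
by rewrite sum_ltr; field.
Qed.

Lemma cremona_reflection (D : cls) (i : 'I_s) : i = 0%N :> nat ->
  cremona r D = D - (2 * B1 r D (X i)) *: X i.
Proof.
move=> i0; rewrite B1_X0 // X0E //=.
case: D => d m; rewrite /cremona /=.
set t := _ - _; have -> : 2 * (- 2^-1 * t) = - t by field.
congr pair => /=; first by rewrite /GRing.scale /= mulr1 opprK.
apply/rowP => j; rewrite !mxE; case: ltnP => _;
  rewrite /= ?mulr0n ?mulr1n; ring.
Qed.

Lemma permute_reflection (D : cls) (i : 'I_s) : (0 < i)%N ->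
  permute (tau i) D = D - (2 * B1 r D (X i)) *: X i.
Proof.
move=> i0; rewrite B1_XS // XSE //=.
case: D => d m; rewrite /permute /=.
set t := m 0 i - _; have -> : 2 * (2^-1 * t) = t by field.
congr pair => /=; first by rewrite /GRing.scale /= mulr0 subr0.
have pi := ord_pred_neq i0.
apply/rowP => j; rewrite !mxE /tau tpermV -(ord_predE i0) val_eqE /t.
case: tpermP => [->|->|/eqP/negPf -> /eqP/negPf ->].
- by rewrite (negPf pi) eqxx /=; ring.
- by rewrite eqxx eq_sym (negPf pi) /=; ring.
- by rewrite subrr; ring.
Qed.

Lemma permuteM p q (D : cls) : permute p (permute q D) = permute (q * p)%g D.
Proof. by congr pair; apply/rowP => j; rewrite !mxE invMg permM. Qed.

Lemma permute1 (D : cls) : permute 1%g D = D.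
Proof.
by case: D => d m; congr pair; apply/rowP => j; rewrite !mxE invg1 perm1.
Qed.

Lemma T_edge_sym : symmetric (T_edge r s).
Proof. by move=> i j; rewrite /T_edge orbC. Qed.

Lemma alpha_exists :
  exists alpha : {multiplicative coxeter (T_edge r s) -> W1 K r s},
  [/\ forall g, exists w, alpha w = g,
      forall p : 'S_s, exists w, restricts_to (alpha w) (@permute K s p),
      forall i : 'I_s, i = 0%N :> nat ->
        restricts_to (alpha (cox_gen (T_edge r s) i)) (@cremona K r s)
    & forall i : 'I_s, (0 < i)%N ->
        restricts_to (alpha (cox_gen (T_edge r s) i)) (@permute K s (tau i))].
Proof.
pose b (u v : V) := B1 r (vsval u) (vsval v).
pose x i : V := vsproj _ (X i).
have xE i : vsval (x i) = X i by rewrite vsprojK // X_V1.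
have b_linear y a u v : b (a *: u + v) y = a * b u y + b v y.
  exact: B1_linear.
have b_gram i j : b (x i) (x j) = cox_gram K (T_edge r s) i j.
  by rewrite /b !xE B1_gram.
pose f i v := v - (2 * b v (x i)) *: x i.
have f_linear i : linear (f i).
  move=> a u v; rewrite /f b_linear mulrDr scalerDl.
  rewrite mulrCA -(scalerA a) scalerBr -!addrA; congr (_ + _).
  by rewrite opprD addrCA.
have f0 (i : 'I_s) v : i = 0%N :> nat -> vsval (f i v) = cremona r (vsval v).
  by move=> i0; rewrite (cremona_reflection _ i0) -xE.
have fS (i : 'I_s) v : (0 < i)%N -> vsval (f i v) = permute (tau i) (vsval v).
  by move=> i0; rewrite (permute_reflection _ i0) -xE.
have /choice[F FE] : forall i,
    exists g : W1 K r s, forall v, W1_glv g v = f i v.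
  move=> i; pose ra := GRing.isLinear.Build K _ _ *:%R _ (f_linear i).
  pose rl : {linear V -> V} := HB.pack (f i) ra.
  have [|g gE] := @glv_of_can _ _ (linfun rl) (linfun rl).
    by move=> v; rewrite !lfunE /=; apply: (reflK b_linear b_gram).
  have gP : `[< generated_by (@W1_generator K r s) g >].
    apply/asboolP/gen_in; have [i0|i0] := posnP i; [left|right].
      by move=> v; rewrite gE lfunE; apply: f0.
    by exists (tau i) => v; rewrite gE lfunE; apply: fS.
  by exists (MkW1 gP) => v; rewrite gE lfunE.
have [alpha alphaE] := coxeter_act_reflections b_linear T_edge_sym b_gram
  (act := @W1_glv K r s) val_inj (fun _ _ => erefl) FE.
have alphaM v w : alpha (v * w)%g = (alpha v * alpha w)%g by apply: gmulfM.
have alpha1 : alpha 1%g = 1%g.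
  by apply: (mulgI (alpha 1%g)); rewrite -alphaM !mulg1.
have ex1 (p : 'S_s) : p = 1%g ->
    exists w, restricts_to (alpha w) (@permute K s p).
  by move=> ->; exists 1%g => v; rewrite alpha1 permute1 glv1.
have exM p q : (exists w, restricts_to (alpha w) (@permute K s p)) ->
    (exists w, restricts_to (alpha w) (@permute K s q)) ->
    exists w, restricts_to (alpha w) (@permute K s (p * q)%g).
  move=> [v vE] [w wE]; exists (w * v)%g => u.
  by rewrite alphaM glvM wE vE permuteM.
have ex_tau (i : 'I_s) : (0 < i)%N ->
    exists w, restricts_to (alpha w) (@permute K s (tau i)).
  by move=> i0; exists (cox_gen _ i) => v; rewrite alphaE FE fS.
have ex_lt n (i j : 'I_s) : j = (i + n.+1)%N :> nat ->
    exists w, restricts_to (alpha w) (@permute K s (tperm i j)).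
  elim: n j => [|n IHn] j ij; have j0 : (0 < j)%N by lia.
    have -> : i = ord_pred j.
      by apply/val_inj; rewrite [RHS]ord_predE // ij addn1.
    exact: ex_tau.
  have /IHn ex_pred : ord_pred j = (i + n.+1)%N :> nat.
    by rewrite ord_predE // ij; lia.
  have -> : tperm i j = (tau j * (tperm i (ord_pred j) * tau j))%g.
    rewrite -{1}[tau j]tpermV -/(tau j) -/((_ ^ _)%g) tpermJ /tau tpermL.
    rewrite tpermD //.
      by rewrite ord_eqE ord_predE //; lia.
    by rewrite ord_eqE; lia.
  exact/exM/exM/ex_tau/j0/ex_pred/ex_tau.
have ex_tperm i j : exists w, restricts_to (alpha w) (@permute K s (tperm i j)).
  have [ij|ji|/val_inj ->] := ltngtP i j; last exact/ex1/tperm1.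
    by apply: (ex_lt (j - i.+1)%N); lia.
  by rewrite tpermC; apply: (ex_lt (i - j.+1)%N); lia.
have ex_perm p : exists w, restricts_to (alpha w) (@permute K s p).
  have [ts -> _] := prod_tpermP p.
  elim: ts => [|t ts IHts]; first by rewrite big_nil; apply: ex1.
  by rewrite big_cons; apply: exM.
have lift (g : GLV V) : generated_by (@W1_generator K r s) g ->
    exists w, W1_glv (alpha w) = g.
  elim=> {g} [g [gE|[p gE]]| |g h _ [v <-] _ [w <-]|g _ [w <-]].
  - have s0 : (0 < s)%N by apply: leq_trans lt_rs.
    exists (cox_gen _ (Ordinal s0)); apply: glvP => v; apply/val_inj.
    by rewrite alphaE FE /= gE -(f0 (Ordinal s0)).
  - have [w wE] := ex_perm p; exists w; apply: glvP => v; apply/val_inj.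
    by rewrite /= wE gE.
  - by exists 1%g; rewrite alpha1.
  - by exists (v * w)%g; rewrite alphaM.
  - exists w^-1%g; apply: (mulgI (W1_glv (alpha w))); rewrite mulgV.
    by have /(congr1 (@W1_glv K r s)) := alphaM w w^-1%g; rewrite mulgV alpha1.
exists alpha; split=> // [g|i i0 v|i i0 v].
- by have [w wE] := lift _ (asboolP _ (W1P g)); exists w; apply: val_inj.
- by rewrite alphaE FE f0.
- by rewrite alphaE FE fS.
Qed.

Lemma beta_exists : exists beta : {linear 'rV[K]_s -> V},
  forall i, vsval (beta (cox_basis K i)) = X i.
Proof.
pose f (x : 'rV[K]_s) : V := \sum_i x 0 i *: vsproj _ (X i).
have f_linear : linear f.
  move=> a u v; rewrite /f scaler_sumr -big_split; apply: eq_bigr => i _ /=.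
  by rewrite !mxE scalerDl scalerA.
pose ra := GRing.isLinear.Build K _ _ *:%R _ f_linear.
pose rl : {linear 'rV[K]_s -> V} := HB.pack f ra.
exists rl => i; rewrite /= /f (bigD1 i) //= mxE !eqxx scale1r big1 => [|j ji].
  by rewrite addr0 vsprojK // X_V1.
by rewrite mxE (negPf ji) andbF scale0r.
Qed.

End AlphaExists.

(* Main.v *)
Require Import Defs.
From mathcomp Require Import all_boot all_order all_fingroup all_algebra reals.
From mathcomp Require Import boolp ring zify.
Set Implicit Arguments.
Unset Strict Implicit.
Unset Printing Implicit Defensive.
Import GRing.Theory Num.Theory.
Local Open Scope ring_scope.

(** The map beta matches the basis x_i of E with the family X_i, and the two
families have the same Gram matrix, so beta preserves the forms
([B1_beta]). The coefficients of a relation between the X_i can be shown to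
vanish one after the other ([beta_inj]), and V1 is a hyperplane of a space of
dimension s + 1, so beta is bijective ([beta_bij]).

Both phi and the transpositions tau_i are the reflections of V1 in the vectors
X_i. An isometry carrying x_i to X_i carries the reflection in x_i to the
reflection in X_i; hence alpha and beta intertwine the actions on generators
and therefore on all of W.

Only the injectivity of alpha is deep. If alpha v = alpha w, then by the
intertwining and the injectivity of beta, v and w act in the same way on E, so
what is needed is the theorem of Tits that the geometric representation is
faithful ([geometric_rep_faithful]). It rests on the relation between length
and signs of roots: if w s_i is not shorter than w, then w x_i has nonnegative
coordinates ([geometric_rep_nonneg]). Given this, a nontrivial w has a last
letter s_j in a reduced word; w s_j is shorter than w, so w s_j x_j = - w x_j
has nonnegative coordinates, which is impossible if w fixes x_j.

In general the sign lemma requires a study of the dihedral subgroups generated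
by two reflections. In a simply laced group, such as this one, these
subgroups have order 4 or 6, and a direct induction on the length of w takes
their place. *)

(** * Length in a Coxeter group *)

Section Length.
Variables (n : nat) (edge : rel 'I_n).
Implicit Types (w : coxeter edge) (u : seq 'I_n).
Local Notation gen := (cox_gen edge).

Lemma cox_word_size_ex w :
  exists k, `[< exists2 u, size u = k & cox_word edge u = w >].
Proof.
exists (size (cox_repr w)); apply/asboolP.
by exists (cox_repr w); rewrite // cox_reprK.
Qed.

Definition cox_length w := ex_minn (cox_word_size_ex w).

Lemma cox_length_word u : (cox_length (cox_word edge u) <= size u)%N.
Proof.
by rewrite /cox_length; case: ex_minnP => k _; apply; apply/asboolP; exists u.
Qed.

Lemma cox_reduced w : exists2 u, size u = cox_length w & cox_word edge u = w.
Proof. by rewrite /cox_length; case: ex_minnP => k /asboolP. Qed.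

Lemma cox_word_rcons u i :
  cox_word edge (rcons u i) = (cox_word edge u * gen i)%g.
Proof. by rewrite -cats1 -cox_mul_word. Qed.

Lemma cox_lengthM w i : (cox_length (w * gen i)%g <= (cox_length w).+1)%N.
Proof.
have [u <- uw] := cox_reduced w.
by rewrite -{1}uw -cox_word_rcons -(size_rcons u i) cox_length_word.
Qed.

Lemma cox_genK i : involutive (fun w => w * gen i)%g.
Proof.
move=> w; rewrite -mulgA.
have -> : (gen i * gen i)%g = 1%g.
  rewrite [LHS](cox_mul_word edge [:: i] [:: i]); apply/cox_wordP.
  exact: (cox_step [::] [::] (cox_invol edge i)).
by rewrite mulg1.
Qed.

Lemma cox_genC i j : i != j -> ~~ edge i j ->
  (gen i * gen j = gen j * gen i)%g.
Proof.
move=> ij eij; rewrite [LHS](cox_mul_word edge [:: i] [:: j]).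
rewrite [RHS](cox_mul_word edge [:: j] [:: i]); apply/cox_wordP.
exact: (cox_step [::] [::] (cox_comm ij eij)).
Qed.

Lemma cox_gen_braid i j : i != j -> edge i j ->
  (gen i * gen j * gen i = gen j * gen i * gen j)%g.
Proof.
move=> ij eij.
have wordE k l :
    (gen k * gen l * gen k)%g = cox_word edge [:: k; l; k].
  by rewrite (cox_wordE edge [:: k; l; k]) !big_cons big_nil mulg1 mulgA.
rewrite !wordE; apply/cox_wordP.
exact: (cox_step [::] [::] (cox_braid ij eij)).
Qed.

(** The last letter of a reduced word can be cancelled. *)
Lemma cox_descent w : w <> 1%g ->
  exists i, (cox_length (w * gen i)%g < cox_length w)%N.
Proof.
have [u <- <-] := cox_reduced w; case/lastP: u => [//|u i] _.
exists i; rewrite cox_word_rcons (cox_genK i) size_rcons ltnS.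
exact: cox_length_word.
Qed.

End Length.

(** * Faithfulness of the geometric representation *)

Lemma multiplicative1 (G H : groupType) (f : {multiplicative G -> H}) :
  f 1%g = 1%g.
Proof. by apply: (mulgI (f 1%g)); rewrite -gmulfM !mulg1. Qed.

Section GeometricRepresentation.
Variables (K : realFieldType) (n : nat) (edge : rel 'I_n).
Local Notation form := (@cox_form K n edge).
Local Notation x_ := (@cox_basis K n).

Lemma cox_form_basis i j : form (x_ i) (x_ j) = cox_gram K edge i j.
Proof.
rewrite /cox_form (bigD1 i) //= (bigD1 j) //= !mxE !eqxx /= !mul1r.
rewrite !big1 ?addr0 // => [k /negPf ki|k /negPf kj].
  by rewrite big1 // => l _; rewrite !mxE ki andbF !mul0r.
by rewrite !mxE kj andbF mulr0 mul0r.
Qed.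

Lemma cox_reflection_self i : cox_reflection edge i (x_ i) = - x_ i.
Proof.
rewrite /cox_reflection cox_form_basis /cox_gram eqxx mulr1.
by rewrite scaler_nat mulr2n opprD addNKr.
Qed.

Lemma cox_reflection_commuting i j : i != j -> ~~ edge i j ->
  cox_reflection edge j (x_ i) = x_ i.
Proof.
move=> /negPf ij /negPf eij.
by rewrite /cox_reflection cox_form_basis /cox_gram ij eij mulr0 scale0r subr0.
Qed.

Lemma cox_reflection_edge i j : i != j -> edge i j ->
  cox_reflection edge j (x_ i) = x_ i + x_ j.
Proof.
move=> /negPf ij eij; rewrite /cox_reflection cox_form_basis /cox_gram ij eij.
by rewrite mulrN divff ?pnatr_eq0 // scaleN1r opprK.
Qed.

Hypothesis edge_sym : symmetric edge.
Variable rho : {multiplicative coxeter edge -> GLV 'rV[K]_n}.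
Hypothesis rhoE : is_geometric_rep rho.
Local Notation gen := (cox_gen edge).

Definition nonneg_row (x : 'rV[K]_n) := forall k, 0 <= x 0 k.

Lemma rhoM v w x : rho (v * w)%g x = rho v (rho w x).
Proof. by rewrite gmulfM glvM. Qed.

Lemma rho1 x : rho 1%g x = x.
Proof. by rewrite multiplicative1 glv1. Qed.

(** Strong induction on the length of w. Choose j such that u = w s_j is
shorter than w; then j <> i. If s_i and s_j commute, then w x_i = u x_i, and
the hypothesis on w passes to u. If they satisfy the braid relation, then
w x_i = u x_i + u x_j; the second summand is nonnegative by induction since
u s_j = w, and so is the first unless u s_i is shorter than u. In that case,
with v = u s_i, one has w x_i = v s_i s_j x_i = v x_j, and the braid relation
w s_i = v s_j s_i s_j shows that v s_j is not shorter than v, for otherwise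
w s_i would be shorter than w. *)
Lemma geometric_rep_nonneg w i :
  (cox_length w <= cox_length (w * gen i)%g)%N -> nonneg_row (rho w (x_ i)).
Proof.
have [m] := ubnP (cox_length w); elim: m w i => // m IHm w i lew lewi.
have [->|/eqP/cox_descent[j ltwj]] := eqVneq w 1%g.
  by move=> k; rewrite rho1 mxE; case: (_ && _).
have ij : i != j by apply: contraTneq ltwj => <-; rewrite -leqNgt.
pose u := (w * gen j)%g; have wE : w = (u * gen j)%g by rewrite /u (cox_genK j).
have ltu : (cox_length u < cox_length w)%N by [].
have [eij|eij] := boolP (edge i j); last first.
  (* A descent of u at i would be a descent of w at i: w s_i = u s_i s_j. *)
  rewrite wE rhoM rhoE cox_reflection_commuting //; apply: IHm; first by lia.
  rewrite leqNgt; apply/negP => ltui.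
  have := cox_lengthM (u * gen i)%g j.
  rewrite -mulgA cox_genC // mulgA -wE => lewui.
  by have := leq_trans lewi (leq_trans lewui ltui); rewrite leqNgt ltu.
have eji : edge j i by rewrite edge_sym.
rewrite wE rhoM rhoE cox_reflection_edge //.
have [leui|ltui] := leqP (cox_length u) (cox_length (u * gen i)%g).
  move=> k; rewrite raddfD mxE addr_ge0 //; apply: IHm; [lia|by []|lia|].
  by rewrite -wE; lia.
pose v := (u * gen i)%g; have uE : u = (v * gen i)%g by rewrite /v (cox_genK i).
have ltv : (cox_length v < cox_length u)%N by [].
rewrite uE rhoM rhoE.
have -> : cox_reflection edge i (x_ i + x_ j) = x_ j.
  rewrite -rhoE raddfD /= !rhoE cox_reflection_self cox_reflection_edge //.
    by rewrite addrC addrK.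
  by rewrite eq_sym.
apply: IHm; first by lia.
rewrite leqNgt; apply/negP => ltvj.
have wiE : (w * gen i = v * gen j * gen i * gen j)%g.
  by rewrite wE uE -!(mulgA v) cox_gen_braid // !mulgA.
have := cox_lengthM (v * gen j * gen i)%g j.
rewrite -wiE => /(leq_trans lewi) lewvji.
have := leq_ltn_trans (cox_lengthM (v * gen j)%g i) (leq_ltn_trans ltvj ltv).
by move/(leq_trans lewvji); rewrite leqNgt ltu.
Qed.

(** If w <> 1 fixes every vector and w s_j is shorter than w, the sign lemma
applied to w s_j says that - x_j has nonnegative coordinates. *)
Theorem geometric_rep_faithful : injective rho.
Proof.
have ker1 w : (forall x, rho w x = x) -> w = 1%g.
  move=> wid; apply: contrapT => /cox_descent[j ltwj].
  have : (cox_length (w * gen j)%g <= cox_length (w * gen j * gen j)%g)%N.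
    by rewrite (cox_genK j) ltnW.
  move=> /geometric_rep_nonneg /(_ j).
  rewrite rhoM rhoE cox_reflection_self wid !mxE !eqxx /= oppr_ge0.
  by rewrite ler10.
move=> v w vw; apply: (mulgI v^-1%g); rewrite mulVg; apply/esym/ker1 => x.
by rewrite rhoM -vw -rhoM mulVg rho1.
Qed.

End GeometricRepresentation.

(** * The comparison map beta *)

Lemma dim_V1 (K : realFieldType) (r s : nat) : \dim (V1 K r s) = s.
Proof.
have := limg_ker_dim (linfun (@degF K r s)) fullv.
have -> : \dim (linfun (@degF K r s) @: fullv) = 1%N.
  apply/eqP; rewrite -[X in _ == X](dimvf K^o) eqn_leq dimvS ?subvf //=.
  apply: dimvS; apply/subvP => a _.
  (* The class (a / (r + 1)) H has degree a against F. *)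
  have -> : a = linfun (@degF K r s) (a / r.+1%:R, 0).
    rewrite lfunE /= degFE /= big1 => [|j _]; last by rewrite mxE.
    by rewrite subr0 mulrC divfK ?pnatr_eq0.
  exact/memv_img/memvf.
rewrite capfv dimvf addn1.
by rewrite [dim _](_ : _ = s.+1) => [[]|] //; rewrite -[X in X.+1]mul1n.
Qed.

Section Beta.
Variables (K : realFieldType) (r s : nat).
Hypothesis lt_rs : (r < s)%N.
Local Notation V := (subvs_of (V1 K r s)).
Local Notation edge := (T_edge r s).
Variable beta : {linear 'rV[K]_s -> V}.
Hypothesis betaE : forall i : 'I_s, vsval (beta (cox_basis K i)) = clsX K r i.

Lemma betaE_sum x : vsval (beta x) = \sum_i x 0 i *: clsX K r i.
Proof.
rewrite [x in beta x]row_sum_delta !linear_sum; apply: eq_bigr => i _ /=.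
by rewrite !linearZ /= -betaE.
Qed.

Lemma B1_beta x y : B1 r (vsval (beta x)) (vsval (beta y)) = cox_form edge x y.
Proof.
have B10 D : B1 r 0 D = 0 :> K.
  by rewrite -(subrr D) addrC -scaleN1r B1_linear; ring.
have B1l D z : B1 r (vsval (beta z)) D = \sum_i z 0 i * B1 r (clsX K r i) D.
  rewrite betaE_sum; elim/big_rec2: _ => [|i a E _ <-]; first exact: B10.
  exact: B1_linear.
rewrite B1l /cox_form; apply: eq_bigr => i _.
rewrite B1_sym B1l mulr_sumr; apply: eq_bigr => j _.
by rewrite B1_sym B1_gram // mulrA.
Qed.

Lemma beta_cox_reflection i x :
  vsval (beta (cox_reflection edge i x)) =
  vsval (beta x) - (2 * B1 r (vsval (beta x)) (clsX K r i)) *: clsX K r i.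
Proof. by rewrite !linearB !linearZ /= -betaE B1_beta. Qed.

(** Let sum_i x_i X_i = 0. The coefficient of H is x_0, so x_0 = 0. For i > 0
the multiplicity at the point of index i - 1 involves only x_0, x_{i-1} and
x_i, the last with coefficient -1, so the x_i vanish one after the other. *)
Lemma beta_inj : injective beta.
Proof.
apply/raddf_inj => x bx0.
have fstE : (vsval (beta x)).1 = \sum_(i < s | i == 0%N :> nat) x 0 i.
  rewrite betaE_sum.
  have -> : (\sum_i x 0 i *: clsX K r i).1 = \sum_i x 0 i * (clsX K r i).1.
    by elim/big_rec2: _ => // i a b _ <-.
  rewrite [RHS]big_mkcond; apply: eq_bigr => i _.
  have [i0|i0] := posnP i; first by rewrite X0E //= mulr1.
  by rewrite XSE //= mulr0.
have sndE j : (vsval (beta x)).2 0 j = \sum_i x 0 i * (clsX K r i).2 0 j.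
  rewrite betaE_sum; elim/big_rec2: _ => [|i a b _ <-]; first by rewrite mxE.
  by rewrite !mxE.
suff x0 m (i : 'I_s) : i = m :> nat -> x 0 i = 0.
  by apply/rowP => i; rewrite mxE (x0 i).
elim/ltn_ind: m i => m IHm i im; have [i0|i0] := posnP i.
  move: fstE; rewrite bx0 /= (bigD1 i) ?i0 //= big1 ?addr0 // => j.
  by rewrite ord_eqE i0 => /andP[-> ].
(* X_k with k > 0 is supported at the ordinals k - 1 and k. *)
have := sndE (ord_pred i); rewrite bx0 /= mxE (bigD1 i) //= big1 => [|k ki].
  rewrite XSE //= !mxE (negPf (ord_pred_neq lt_rs i0)) (ord_predE i0).
  rewrite eqxx sub0r addr0.
  by rewrite mulrN1 => /esym/eqP; rewrite oppr_eq0 => /eqP.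
have [km|mk] := ltnP k m; first by rewrite (IHm k) ?mul0r.
rewrite XSE /=; last by lia.
move: ki; rewrite mxE !ord_eqE ord_predE // => ki.
have -> : (i.-1 == k :> nat) = false by lia.
have -> : (i.-1 == k.-1 :> nat) = false by lia.
by rewrite subrr mulr0.
Qed.

Lemma beta_bij : bijective beta.
Proof.
pose f := linfun beta.
have fE x : f x = beta x by rewrite lfunE.
have ker0 : lker f == 0%VS.
  by apply/lker0P => x y; rewrite !fE; apply: beta_inj.
have img : limg f = fullv.
  apply/eqP; rewrite eqEdim subvf /=.
  rewrite limg_dim_eq ?(eqP ker0) ?capv0 //.
  by rewrite !dimvf [X in (X <= _)%N]dim_V1 /dim /= mul1n.
exists (f^-1)%VF => x; first by rewrite -fE lker0_lfunK.
by rewrite -fE limg_lfunVK // img memvf.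
Qed.

End Beta.

(** * The theorem *)

Theorem proposition4p5 (R : realType) (r s : nat)
    (hr : (2 <= r)%N) (hs : (r + 3 <= s)%N)
    (rho : {multiplicative coxeter (T_edge r s) -> GLV 'rV[R]_s})
    (rhoE : is_geometric_rep rho)
    (alpha : {multiplicative coxeter (T_edge r s) -> W1 R r s})
    (alpha_surj : forall g : W1 R r s, exists w, alpha w = g)
    (alpha0 : forall i : 'I_s, i = 0%N :> nat ->
      restricts_to (alpha (cox_gen (T_edge r s) i)) (@cremona R r s))
    (alphaS : forall i : 'I_s, (0 < i)%N ->
      restricts_to (alpha (cox_gen (T_edge r s) i)) (@permute R s (tau i)))
    (beta : {linear 'rV[R]_s -> subvs_of (V1 R r s)})
    (betaE : forall i : 'I_s, vsval (beta (cox_basis R i)) = clsX R r i) :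
  [/\ bijective alpha,
      bijective beta /\
        (forall x y, B1 r (vsval (beta x)) (vsval (beta y))
                     = cox_form (T_edge r s) x y)
    & forall w x, beta (rho w x) = alpha w (beta x)].
Proof.
have lt_rs : (r < s)%N by lia.
have alphaM v w x : alpha (v * w)%g x = alpha v (alpha w x).
  by rewrite gmulfM; apply: glvM.
have equiv_gen i x :
    beta (rho (cox_gen _ i) x) = alpha (cox_gen _ i) (beta x).
  apply/val_inj; rewrite /= rhoE beta_cox_reflection //.
  have [i0|i0] := posnP i.
    by rewrite alpha0 // (cremona_reflection r _ i0).
  by rewrite alphaS // (permute_reflection lt_rs _ i0).
have equiv w x : beta (rho w x) = alpha w (beta x).
  rewrite -[w]cox_reprK; elim: (cox_repr w) x => [|i u IHu] x.
    by rewrite [cox_word _ _](_ : _ = 1%g) // rho1 multiplicative1 glv1.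
  have -> : cox_word (T_edge r s) (i :: u) = (cox_gen _ i * cox_word _ u)%g.
    by rewrite [RHS](cox_mul_word _ [:: i] u).
  by rewrite rhoM alphaM equiv_gen IHu.
have beta_bijective := beta_bij lt_rs betaE.
split=> //; last by split=> // x y; apply: B1_beta.
have alpha_inj : injective alpha.
  move=> v w vw; apply: (geometric_rep_faithful (T_edge_sym r (s := s)) rhoE).
  by apply: glvP => x; apply: (bij_inj beta_bijective); rewrite !equiv vw.
have [g gE] := choice alpha_surj.
by exists g => // w; apply: alpha_inj; rewrite gE.
Qed.
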